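(* Let $(M,\varphi,\xi_\alpha,\eta^\alpha,g)$ be a Lorentzian $g.f.f$-manifold with $\dim(M)=2n+s$, $s\geqslant1$, where $\xi_1$ denotes the timelike characteristic vector field. Fix $p\in M$ and let $F\colon(T_pM)^4\to\mathbb{R}$ be a curvature-like map satisfying $$F(x,\xi_\alpha,y,\xi_\beta)=\varepsilon_\alpha\varepsilon_\beta\, g(\varphi x,\varphi y)\qquad\text{and}\qquad F(\varphi x,\varphi y,\varphi z,\xi_\alpha)=0$$ for any $x,y,z\in T_pM$ and $\alpha,\beta\in\{1,\dots,s\}$ (all tensors evaluated at $p$). The following statements are equivalent. (a) $F(u,y,u,y)=0$ on any degenerate $2$-plane $\mathrm{span}\{u,y\}$ with $u\in N_\varphi((\xi_1)_p)$ and $y\in u^\bot\cap\mathrm{Im}(\varphi_p)$; (b) $F(x,y,z,w)=g_p(S_p(x,y)z,w)-g_p(T_p(x,y)z,w)$ for any $x,y,z,w\in T_pM$.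
   Context: All manifolds are smooth and connected. Globally framed $f$-manifolds. A globally framed $f$-manifold ($g.f.f$-manifold) $(M,\varphi,\xi_\alpha,\eta^\alpha)$, $\alpha\in\{1,\dots,s\}$, $s\ge 1$, $\dim M=2n+s$, is a manifold with a non-vanishing $(1,1)$-tensor field $\varphi$ of constant rank $2n$, vector fields $\xi_1,\dots,\xi_s$ and $1$-forms $\eta^1,\dots,\eta^s$ such that $\varphi^2=-I+\sum_{\alpha}\eta^\alpha\otimes\xi_\alpha$ and $\eta^\alpha(\xi_\beta)=\delta^\alpha_\beta$ (so $\varphi^3+\varphi=0$, $\varphi\xi_\alpha=0$, $\eta^\alpha\circ\varphi=0$, and $T_pM=\mathrm{Im}(\varphi_p)\oplus\mathrm{span}((\xi_1)_p,\dots,(\xi_s)_p)$). The $\xi_\alpha$ are the characteristic vector fields. A Lorentzian $g.f.f$-manifold $(M,\varphi,\xi_\alpha,\eta^\alpha,g)$ is one endowed with a Lorentzian metric $g$ (exactly one minus sign) that is compatible: $g(\varphi X,\varphi Y)=g(X,Y)-\sum_\alpha\varepsilon_\alpha\eta^\alpha(X)\eta^\alpha(Y)$, where $\varepsilon_\alpha=g(\xi_\alpha,\xi_\alpha)=\pm1$. Then exactly one of the $\xi_\alpha$ is timelike, and it is always labelled $\xi_1$ (so $\varepsilon_1=-1$, $\varepsilon_\alpha=1$ for $\alpha\ge2$). Put $\tilde\xi=\sum_{\alpha=1}^s\xi_\alpha$ and $\tilde\eta=\sum_{\alpha=1}^s\varepsilon_\alpha\eta^\alpha$. The $(1,3)$-tensors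 $T$ and $S$ are $$T(X,Y)Z=g(\varphi Y,\varphi Z)\tilde\eta(X)\tilde\xi-g(\varphi X,\varphi Z)\tilde\eta(Y)\tilde\xi-\tilde\eta(Y)\tilde\eta(Z)\varphi^2X+\tilde\eta(X)\tilde\eta(Z)\varphi^2Y,$$ $$S(X,Y)Z=g(\varphi X,\varphi Z)\varphi^2Y-g(\varphi Y,\varphi Z)\varphi^2X.$$ A multilinear map $F\colon(T_pM)^4\to\mathbb{R}$ is curvature-like if $F(x,y,z,w)=F(z,w,x,y)$, $F(x,y,z,w)=-F(y,x,z,w)=-F(x,y,w,z)$ and $F(x,y,z,w)+F(y,z,x,w)+F(z,x,y,w)=0$ for all $x,y,z,w$. $N_\varphi((\xi_1)_p)=\{(\xi_1)_p+x : x\in\mathrm{Im}(\varphi_p),\ g_p(x,x)=1\}$. A $2$-plane $\mathrm{span}\{x,y\}\subset T_pM$ is degenerate if $g_p(x,x)g_p(y,y)-g_p(x,y)^2=0$. *)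

(* Defs.v *)
From HB Require Import structures.
From mathcomp Require Import all_boot all_order all_algebra.
From mathcomp Require Import ring.
From mathcomp Require Import all_classical all_reals all_analysis.

Set Implicit Arguments.
Unset Strict Implicit.
Unset Printing Implicit Defensive.

Import Order.TTheory GRing.Theory Num.Theory.
Import numFieldNormedType.Exports.
Local Open Scope classical_set_scope.
Local Open Scope ring_scope.

(** * Smooth manifolds *)

Section Smoothness.
Context {R : realType} {m : nat} {W : normedModType R}.
Implicit Types (A : set 'rV[R]_m) (f : 'rV[R]_m -> W).

(* [A] is meant to be open. *)
Fixpoint Ck_on (k : nat) A f : Prop :=
  match k with
  | 0 => forall x, A x -> {for x, continuous f}
  | k'.+1 => (forall x, A x -> differentiable f x) /\
             (forall v, Ck_on k' A (fun x => 'D_v f x))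
  end.

Definition smooth_on A f : Prop := forall k, Ck_on k A f.

End Smoothness.

(* The values of [chart_fun] outside [chart_dom] and of [chart_inv] outside
   [chart_cod] are irrelevant. *)
Record chart (R : realType) (m : nat) (M : topologicalType) := Chart {
  chart_dom : set M;
  chart_cod : set 'rV[R]_m;
  chart_fun : M -> 'rV[R]_m;
  chart_inv : 'rV[R]_m -> M;
  chart_dom_open : open chart_dom;
  chart_cod_open : open chart_cod;
  chart_funS : forall x, chart_dom x -> chart_cod (chart_fun x);
  chart_invS : forall v, chart_cod v -> chart_dom (chart_inv v);
  chart_funK : forall x, chart_dom x -> chart_inv (chart_fun x) = x;
  chart_invK : forall v, chart_cod v -> chart_fun (chart_inv v) = v;
  chart_fun_continuous : {within chart_dom, continuous chart_fun};
  chart_inv_continuous : {within chart_cod, continuous chart_inv}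
}.

Record smooth_manifold (R : realType) (m : nat) := SmoothManifold {
  mfd_space :> topologicalType;
  mfd_hausdorff : hausdorff_space mfd_space;
  mfd_second_countable : @second_countable mfd_space;
  mfd_connected : connected [set: mfd_space];
  atlas : set (chart R m mfd_space);
  atlas_cover : forall x, exists2 c, atlas c & chart_dom c x;
  atlas_smooth : forall c d, atlas c -> atlas d ->
    smooth_on (chart_fun c @` (chart_dom c `&` chart_dom d))
              (chart_fun d \o chart_inv c)
}.

Section Tangent.
Context {R : realType} {m : nat} (M : smooth_manifold R m).

Definition smooth_map (f : M -> R) : Prop :=
  forall c, atlas c -> smooth_on (chart_cod c) (f \o chart_inv c).

Record smooth_fun := SmoothFun {
  smooth_val :> M -> R;
  smooth_valP : smooth_map smooth_val
}.

(* Derivations of the algebra of smooth functions at [p]; [h] stands for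
   [a f + b], resp. [f g], as an element of [smooth_fun]. *)
Definition derivation_at (p : M) : {pred smooth_fun -> R^o} := fun D =>
  `[< (forall (a : R) (f g h : smooth_fun),
         (forall q, h q = a * f q + g q) -> D h = a * D f + D g) /\
      (forall f g h : smooth_fun,
         (forall q, h q = f q * g q) -> D h = f p * D g + g p * D f) >].

Lemma derivation_at_submod (p : M) : submod_closed (derivation_at p).
Proof.
split=> [|b D E /asboolP[Dl Dm] /asboolP[El Em]]; apply/asboolP; split.
- by move=> a f g h _; rewrite /= mulr0 addr0.
- by move=> f g h _; rewrite /= !mulr0 addr0.
- move=> a f g h hE; have := Dl _ _ _ _ hE; have := El _ _ _ _ hE.
  rewrite -![(b *: D + E) _]/(b * D _ + E _) => -> ->; ring.
- move=> f g h hE; have := Dm _ _ _ hE; have := Em _ _ _ hE.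
  rewrite -![(b *: D + E) _]/(b * D _ + E _) => -> ->; ring.
Qed.

HB.instance Definition _ (p : M) :=
  GRing.isSubmodClosed.Build R (smooth_fun -> R^o) (derivation_at p)
    (derivation_at_submod p).

Record tangent (p : M) := Tangent {
  tangent_val :> smooth_fun -> R^o;
  tangent_valP : tangent_val \in derivation_at p
}.

HB.instance Definition _ (p : M) := [isSub for @tangent_val p].
HB.instance Definition _ (p : M) := [Choice of tangent p by <:].
HB.instance Definition _ (p : M) :=
  [SubChoice_isSubLmodule of tangent p by <:].

Definition vector_field := forall p : M, tangent p.

Definition smooth_vector_field (X : vector_field) : Prop :=
  forall f : smooth_fun, smooth_map (fun p => X p f).

End Tangent.

(** * Linear algebra *)

Section LinearAlgebra.
Context {R : realType} {V : lmodType R}.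

Definition free_family k (e : 'I_k -> V) : Prop :=
  forall c : 'I_k -> R, \sum_i c i *: e i = 0 -> forall i, c i = 0.

Definition basis_of_set k (A : set V) (e : 'I_k -> V) : Prop :=
  [/\ forall i, A (e i), free_family e
    & forall v, A v -> exists c : 'I_k -> R, v = \sum_i c i *: e i].

Definition has_rank (f : V -> V) (k : nat) : Prop :=
  exists e : 'I_k -> V, basis_of_set (range f) e.

Definition symmetric_bilinear (b : V -> V -> R) : Prop :=
  (forall x y, b x y = b y x) /\ (forall y, scalar (b^~ y)).

(* In some basis, [b] is diagonal with entries one [-1] and [m - 1] times [1];
   in particular [V] has dimension [m]. *)
Definition lorentzian_form (m : nat) (b : V -> V -> R) : Prop :=
  symmetric_bilinear b /\
  exists (e : 'I_m -> V) (i0 : 'I_m), basis_of_set [set: V] e /\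
    forall i j, b (e i) (e j) =
                if i == j then (if i == i0 then -1 else 1) else 0.

Definition multilinear4 (F : V -> V -> V -> V -> R) : Prop :=
  [/\ forall y z w, scalar (fun x => F x y z w),
      forall x z w, scalar (fun y => F x y z w),
      forall x y w, scalar (fun z => F x y z w)
    & forall x y z, scalar (fun w => F x y z w)].

Definition curvature_like (F : V -> V -> V -> V -> R) : Prop :=
  [/\ multilinear4 F,
      forall x y z w, F x y z w = F z w x y,
      forall x y z w, F x y z w = - F y x z w /\ F x y z w = - F x y w z
    & forall x y z w, F x y z w + F y z x w + F z x y w = 0].

Definition degenerate_plane (b : V -> V -> R) (x y : V) : Prop :=
  free_family (tnth [tuple x; y]) /\ b x x * b y y - b x y ^+ 2 = 0.

End LinearAlgebra.

(** * Lorentzian globally framed f-manifolds *)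

(* Smoothness of the tensor fields [phi], [eta] and [g] below is expressed by
   evaluating them on smooth vector fields. *)

Record gff_structure (R : realType) (n s : nat)
    (M : smooth_manifold R (2 * n + s)) := GffStructure {
  phi : forall p : M, {linear tangent p -> tangent p};
  xi : 'I_s -> vector_field M;
  eta : 'I_s -> forall p : M, {scalar tangent p};
  phi_smooth : forall X, smooth_vector_field X ->
    smooth_vector_field (fun p => phi p (X p));
  xi_smooth : forall a, smooth_vector_field (xi a);
  eta_smooth : forall a X, smooth_vector_field X ->
    smooth_map (fun p => eta a p (X p));
  phi_nonvanishing : forall p, exists x, phi p x != 0;
  phi_rank : forall p, has_rank (phi p) (2 * n);
  phi_sqr : forall p x,
    phi p (phi p x) = - x + \sum_a eta a p x *: xi a p;
  eta_xi : forall p a b, eta a p (xi b p) = (a == b)%:R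
}.

Record lorentzian_metric (R : realType) (m : nat) (M : smooth_manifold R m) :=
  LorentzianMetric {
  metric :> forall p : M, tangent p -> tangent p -> R;
  metric_lorentzian : forall p, lorentzian_form m (@metric p);
  metric_smooth : forall X Y, smooth_vector_field X -> smooth_vector_field Y ->
    smooth_map (fun p => metric (X p) (Y p))
}.

Record lorentzian_gff (R : realType) (n s : nat)
    (M : smooth_manifold R (2 * n + s)) := LorentzianGff {
  gff :> gff_structure M;
  gmet : lorentzian_metric M;
  xi_unit : forall p a, gmet p (xi gff a p) (xi gff a p) = 1 \/
                        gmet p (xi gff a p) (xi gff a p) = -1;
  gmet_compatible : forall p (x y : tangent p),
    gmet p (phi gff p x) (phi gff p y) =
    gmet p x y - \sum_a gmet p (xi gff a p) (xi gff a p)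
                        * eta gff a p x * eta gff a p y
}.

Section Tensors.
Context {R : realType} {n s : nat} {M : smooth_manifold R (2 * n + s)}.
Context (G : lorentzian_gff M) (p : M).
Implicit Types x y z w : tangent p.

Local Notation g := (gmet G p).
Local Notation ph := (phi G p).

Definition eps (a : 'I_s) : R := g (xi G a p) (xi G a p).

Definition xi_tilde : tangent p := \sum_a xi G a p.

Definition eta_tilde x : R := \sum_a eps a * eta G a p x.

Definition tensorT x y z : tangent p :=
  (g (ph y) (ph z) * eta_tilde x) *: xi_tilde
  - (g (ph x) (ph z) * eta_tilde y) *: xi_tilde
  - (eta_tilde y * eta_tilde z) *: ph (ph x)
  + (eta_tilde x * eta_tilde z) *: ph (ph y).

Definition tensorS x y z : tangent p :=
  g (ph x) (ph z) *: ph (ph y) - g (ph y) (ph z) *: ph (ph x).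

(* The set [N_phi(v)], used for [v = (xi_1)_p]. *)
Definition Nphi (v : tangent p) : set (tangent p) :=
  [set v + x | x in [set x | range ph x /\ g x x = 1]].

Definition orthogonal_to (u : tangent p) : set (tangent p) :=
  [set y | g u y = 0].

End Tensors.

(* Main.v *)
Require Import Defs.
From HB Require Import structures.
From mathcomp Require Import all_boot all_order all_algebra ring lra.
From mathcomp Require Import all_classical all_reals all_analysis.

Set Implicit Arguments.
Unset Strict Implicit.
Unset Printing Implicit Defensive.

Import Order.TTheory GRing.Theory Num.Theory.
Import numFieldNormedType.Exports.
Local Open Scope classical_set_scope.
Local Open Scope ring_scope.

(** Both sides of (b) are curvature-like, and they agree as soon as a [ξ_a] is
    among the arguments: two such arguments are governed by the first hypothesis
    on [F] together with the Bianchi identity, one by the second. Since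
    [x = - φ² x + Σ_a η^a(x) ξ_a], their difference is determined by its values
    on [Im φ], hence, by polarization, by [F(x, y, x, y)] there. For [x] a unit
    vector and [y] orthogonal to [x] in the positive definite space [Im φ], the
    vector [u = ξ_1 + x] is null and orthogonal to [y], and
    [F(u, y, u, y) = g(y, y) + F(x, y, x, y)]; so (a) amounts to
    [F(x, y, x, y) = - g(x, x) g(y, y)] on orthogonal pairs of [Im φ]. *)

(** * Calculus of linear functionals *)

Section Scalar.
Context {R : realType} {V : lmodType R} (f : V -> R).
Hypothesis f_scalar : scalar f.

Lemma scalarD x y : f (x + y) = f x + f y.
Proof. by have := f_scalar 1 x y; rewrite scale1r mul1r. Qed.

Lemma scalar0 : f 0 = 0.
Proof. by apply: (addrI (f 0)); rewrite -scalarD !addr0. Qed.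

Lemma scalarZ a x : f (a *: x) = a * f x.
Proof. by have := f_scalar a x 0; rewrite scalar0 !addr0. Qed.

Lemma scalarN x : f (- x) = - f x.
Proof. by rewrite -scaleN1r scalarZ mulN1r. Qed.

Lemma scalarBZ a x y : f (y - a *: x) = f y - a * f x.
Proof. by rewrite scalarD scalarN scalarZ. Qed.

Lemma scalar_sum (I : finType) (c : I -> R) (e : I -> V) :
  f (\sum_i c i *: e i) = \sum_i c i * f (e i).
Proof.
rewrite (big_morph f scalarD scalar0).
by apply: eq_bigr => i _; rewrite scalarZ.
Qed.

End Scalar.

(** * Bases, Lorentzian forms and curvature-like maps *)

Section FormsAndFamilies.
Context {R : realType} {V : lmodType R}.

(** The square matrices [A] and [B] expressing each family through the other satisfy [A *m B = 1],
    hence also [B *m A = 1]. A relation [c] among the [f i] gives [c *m B = 0], so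
    [c = c *m B *m A = 0]. *)
Lemma spanning_family_free m (e f : 'I_m -> V) :
  basis_of_set [set: V] e ->
  (forall v, exists c : 'I_m -> R, v = \sum_i c i *: f i) ->
  free_family f.
Proof.
move=> [_ e_free e_span] f_span.
have [a eE] := choice (fun i => f_span (e i)).
have [b fE] := choice (fun i => e_span (f i) I).
pose A : 'M[R]_m := \matrix_(i, j) a i j.
pose B : 'M[R]_m := \matrix_(i, j) b i j.
have comb (c : 'I_m -> R) (C : 'M[R]_m) (g h : 'I_m -> V) :
    (forall i, g i = \sum_j C i j *: h j) ->
    \sum_i c i *: g i = \sum_j ((\row_i c i) *m C) 0 j *: h j.
  move=> gE; under eq_bigr do rewrite gE scaler_sumr.
  rewrite exchange_big /=; apply: eq_bigr => j _.
  rewrite mxE scaler_suml; apply: eq_bigr => i _.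
  by rewrite mxE scalerA.
have AE i : e i = \sum_j A i j *: f j.
  by rewrite eE; apply: eq_bigr => j _; rewrite mxE.
have BE i : f i = \sum_j B i j *: e j.
  by rewrite fE; apply: eq_bigr => j _; rewrite mxE.
have AB1 : A *m B = 1%:M.
  apply/matrixP => i j; apply/eqP; rewrite -subr_eq0; apply/eqP.
  apply: (e_free (fun j => (A *m B) i j - (1%:M : 'M[R]_m) i j)).
  under eq_bigr do rewrite scalerBl.
  rewrite sumrB; apply/eqP; rewrite subr_eq0; apply/eqP.
  have -> : \sum_k (1%:M : 'M[R]_m) i k *: e k = e i.
    rewrite (bigD1 i) //= mxE eqxx scale1r big1 ?addr0 // => k ki.
    by rewrite mxE eq_sym (negbTE ki) scale0r.
  rewrite [in RHS]AE (comb _ _ _ _ BE); apply: eq_bigr => k _.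
  by rewrite !mxE; congr (_ *: _); apply: eq_bigr => l _; rewrite !mxE.
move=> c c0 i.
have cB0 : (\row_i c i) *m B = 0.
  apply/rowP => j; rewrite [RHS]mxE.
  by apply: (e_free (fun j => ((\row_i c i) *m B) 0 j)); rewrite -(comb _ _ _ _ BE).
have : ((\row_i c i) *m B) *m A = 0 by rewrite cB0 mul0mx.
by rewrite -mulmxA (mulmx1C AB1) mulmx1 => /rowP /(_ i); rewrite !mxE.
Qed.

(* With [e i0] the negative basis vector, the combination of [t] and [w] having
   no [e i0]-component lies in a positive definite subspace. *)
Lemma lorentzian_form_pos m (b : V -> V -> R) (t w : V) :
  lorentzian_form m b -> b t t < 0 -> b t w = 0 -> w != 0 -> 0 < b w w.
Proof.
move=> [[bC b_scalar] [e [i0 [[_ _ e_span] be]]]] tt_lt0 tw0 w_neq0.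
have b_scalarr x : scalar (b x).
  by move=> a u v; rewrite !(bC x) b_scalar.
have bE (c : 'I_m -> R) :
    b (\sum_i c i *: e i) (\sum_i c i *: e i) = \sum_i c i ^+ 2 * (if i == i0 then -1 else 1).
  rewrite (scalar_sum (b_scalar _)); apply: eq_bigr => i _.
  rewrite (scalar_sum (b_scalarr _)) (bigD1 i) //= be eqxx big1 ?addr0; last first.
    by move=> j ji; rewrite be eq_sym (negbTE ji) mulr0.
  by rewrite mulrA expr2.
have space_ge0 (c : 'I_m -> R) (v := \sum_i c i *: e i) :
    c i0 = 0 -> 0 <= b v v ?= iff (v == 0).
  move=> c0; have term_ge0 i : 0 <= c i ^+ 2 * (if i == i0 then -1 else 1).
    by case: eqP => [->|_]; rewrite ?c0 ?expr0n ?mul0r // mulr1 sqr_ge0.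
  split; first by rewrite bE sumr_ge0.
  rewrite eq_sym; apply/eqP/eqP; last first => [->|].
    by rewrite (scalar0 (b_scalar _)).
  rewrite bE => /eqP; rewrite psumr_eq0 // => /allP c_eq0.
  apply: big1 => i _; have := c_eq0 i; rewrite mem_index_enum => /(_ isT).
  have [->|_] := eqVneq i i0; first by rewrite c0 scale0r.
  by rewrite mulr1 sqrf_eq0 => /eqP ->; rewrite scale0r.
have [ct tE] := e_span t I; have [cw wE] := e_span w I.
have t0_neq0 : ct i0 != 0.
  apply/eqP => /space_ge0[+ _]; rewrite -tE => /le_lt_trans/(_ tt_lt0).
  by rewrite ltxx.
pose z := cw i0 *: t + (- ct i0) *: w.
have zE : z = \sum_i (cw i0 * ct i - ct i0 * cw i) *: e i.
  rewrite /z {1}tE {1}wE !scaler_sumr -big_split /=; apply: eq_bigr => i _.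
  by rewrite !scalerA -scalerDl mulNr.
have [zz_ge0 zz_eq0] : 0 <= b z z ?= iff (z == 0).
  by rewrite zE; apply: space_ge0; rewrite mulrC subrr.
have zzE : b z z = cw i0 ^+ 2 * b t t + ct i0 ^+ 2 * b w w.
  rewrite /z b_scalar !b_scalarr !(scalarZ (b_scalar _)).
  by rewrite !(scalarZ (b_scalarr _)) (bC w t) tw0; ring.
have t0_gt0 : 0 < ct i0 ^+ 2 by rewrite exprn_even_gt0.
have w0_ge0 : 0 <= cw i0 ^+ 2 by rewrite sqr_ge0.
(* If [b w w <= 0], both summands of [b z z] are nonpositive; this forces [z = 0], then [cw i0 = 0],
   and finally [w = 0]. *)
rewrite ltNge; apply/negP => ww_le0.
have t_le0 : cw i0 ^+ 2 * b t t <= 0 by rewrite mulr_ge0_le0 // ltW.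
have w_le0 : ct i0 ^+ 2 * b w w <= 0 by rewrite pmulr_rle0.
have /eqP : 0 = b z z by apply/eqP; rewrite eq_le zz_ge0 zzE -[leRHS]addr0 lerD.
rewrite zz_eq0 => /eqP z0.
have /eqP : cw i0 ^+ 2 * b t t = 0.
  have : b z z = 0 by rewrite z0 (scalar0 (b_scalar _)).
  by rewrite zzE => ?; lra.
rewrite mulf_eq0 (lt_eqF tt_lt0) orbF sqrf_eq0 => /eqP w0.
move/eqP: z0; rewrite /z w0 scale0r add0r scaler_eq0 oppr_eq0 (negbTE t0_neq0) /=.
exact/negP.
Qed.

(** Polarizing twice makes [K] skew in its first and third arguments as well, and the Bianchi sum
    becomes [3 K x y z w]. *)
Lemma curvature_like_eq0 (K : V -> V -> V -> V -> R) :
  curvature_like K -> (forall x y, K x y x y = 0) ->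
  forall x y z w, K x y z w = 0.
Proof.
move=> [[K1 K2 K3 K4] KP KN KB] Ksec.
have K13 x y w : K x y x w = 0.
  have := Ksec x (y + w).
  rewrite (scalarD (K2 _ _ _)) !(scalarD (K4 _ _ _)) !Ksec.
  by rewrite (KP x w x y); lra.
have K13N x y z w : K z y x w = - K x y z w.
  have := K13 (x + z) y w.
  rewrite (scalarD (K1 _ _ _)) !(scalarD (K3 _ _ _)) !K13; lra.
move=> x y z w; have := KB x y z w.
rewrite (KN y z x w).1 (K13N x y z w) (K13N y x z w) (KN y x z w).1; lra.
Qed.

End FormsAndFamilies.

(** * Pointwise identities for [φ], [ξ], [η] and [g] *)

Section LorentzianGff.
Context {R : realType} {n s : nat} {M : smooth_manifold R (2 * n + s)}.
Context (G : lorentzian_gff M) (p : M).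
Implicit Types x y z w : tangent p.

Local Notation g := (gmet G p).
Local Notation ph := (phi G p).
Local Notation ξ a := (xi G a p).
Local Notation η a := (Defs.eta G a p).
Local Notation h x y := (g (ph x) (ph y)).
Local Notation e := (@eta_tilde _ _ _ _ G p).

Lemma metricC x y : g x y = g y x.
Proof. exact: (metric_lorentzian (gmet G) p).1.1. Qed.

Lemma metric_scalarl y : scalar (fun x => g x y).
Proof. exact: (metric_lorentzian (gmet G) p).1.2. Qed.

Lemma metric_scalarr x : scalar (g x).
Proof. by move=> a u v; rewrite !(metricC x) metric_scalarl. Qed.

Lemma gff_decomp x : x = - ph (ph x) + \sum_a η a x *: ξ a.
Proof. by rewrite phi_sqr opprD opprK addrNK. Qed.

(* [phi_rank] is essential here: a basis of the range and the [ξ a] are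
   [2 * n + s] vectors, and they span since [x = - φ² x + \sum_a η a x *: ξ a]. *)
Lemma phi_range_xi_free x (c : 'I_s -> R) :
  ph x = \sum_a c a *: ξ a -> forall a, c a = 0.
Proof.
have [r [r_range r_free r_span]] := phi_rank G p.
have [_ [b [_ [b_basis _]]]] := metric_lorentzian (gmet G) p.
pose f (i : 'I_(2 * n + s)) :=
  match fintype.split i with inl j => r j | inr a => ξ a end.
have fE (k : 'I_(2 * n) -> R) (d : 'I_s -> R) :
    \sum_i (match fintype.split i with inl j => k j | inr a => d a end) *: f i =
    \sum_j k j *: r j + \sum_a d a *: ξ a.
  rewrite big_split_ord /= /f; congr (_ + _); apply: eq_bigr => i _.
    by rewrite (unsplitK (inl i)).
  by rewrite (unsplitK (inr i)).
have f_free : free_family f.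
  apply: spanning_family_free b_basis _ => v.
  (* By [gff_decomp], the component of [v] in the range is [- φ² v = φ (- φ v)]. *)
  have [|k kE] := r_span (ph (- ph v)); first by exists (- ph v).
  exists (fun i => match fintype.split i with inl j => k j | inr a => η a v end).
  by rewrite fE -kE linearN -gff_decomp.
move=> phE a.
have [|k kE] := r_span (ph x); first by exists x.
have /f_free/(_ (rshift _ a)) :
    \sum_i (match fintype.split i with inl j => k j | inr a => - c a end) *: f i = 0.
  rewrite fE -kE phE -big_split /=; apply: big1 => b' _.
  by rewrite scaleNr subrr.
by rewrite (unsplitK (inr a)) => /eqP; rewrite oppr_eq0 => /eqP.
Qed.

(** Since [φ² ξ_a = 0], the decomposition of [φ ξ_a] has only [ξ] components; but it also lies in
    the range of [φ], so these vanish. *)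
Lemma phi_xi a : ph (ξ a) = 0.
Proof.
have ph2 : ph (ph (ξ a)) = 0.
  rewrite phi_sqr (bigD1 a) //= eta_xi eqxx scale1r big1 ?addr0 ?addNr //.
  by move=> b ba; rewrite eta_xi (negbTE ba) scale0r.
have := gff_decomp (ph (ξ a)).
rewrite ph2 linear0 oppr0 add0r => phE; rewrite phE; apply: big1 => b _.
by rewrite (phi_range_xi_free phE b) scale0r.
Qed.

(** As [φ³ = - φ], the decomposition of [φ x] leaves a relation among the independent [ξ a], with
    coefficients [η a (φ x)]. *)
Lemma eta_phi a x : η a (ph x) = 0.
Proof.
have := gff_decomp (ph x).
have -> : ph (ph (ph x)) = - ph x.
  rewrite [ph (ph x)]phi_sqr linearD linearN linear_sum big1 ?addr0 // => b _.
  by rewrite linearZ /= phi_xi scaler0.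
rewrite opprK => /eqP; rewrite -subr_eq0 opprD addrA subrr add0r oppr_eq0 => /eqP c0.
by apply: (@phi_range_xi_free 0 (fun a => η a (ph x))); rewrite c0 linear0.
Qed.

Lemma eta_scalar a : scalar (η a).
Proof. by move=> c u v; rewrite linearP. Qed.

Lemma metric_xi a y : g (ξ a) y = eps G p a * η a y.
Proof.
have := gmet_compatible G (ξ a) y.
rewrite phi_xi (scalar0 (metric_scalarl _)) (bigD1 a) //= eta_xi eqxx mulr1.
rewrite big1 ?addr0; last by move=> b ba; rewrite eta_xi (negbTE ba) mulr0 mul0r.
by move/eqP; rewrite eq_sym subr_eq0 => /eqP.
Qed.

Lemma metric_phi_sqr x w : g (ph (ph x)) w = - h x w.
Proof.
rewrite phi_sqr (scalarD (metric_scalarl _)) (scalarN (metric_scalarl _)).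
rewrite (scalar_sum (metric_scalarl _)) gmet_compatible opprB addrC.
congr (_ - _); apply: eq_bigr => a _; rewrite metric_xi /eps; ring.
Qed.

Lemma metric_phi_phi x y : h (ph x) (ph y) = h x y.
Proof.
by rewrite gmet_compatible big1 ?subr0 // => a _; rewrite eta_phi mulr0 mul0r.
Qed.

Lemma metric_xi_tilde w : g (xi_tilde G p) w = e w.
Proof.
rewrite /xi_tilde /eta_tilde.
have -> : \sum_a ξ a = \sum_a (1 : R) *: ξ a.
  by apply: eq_bigr => a _; rewrite scale1r.
rewrite (scalar_sum (metric_scalarl _)).
by apply: eq_bigr => a _; rewrite mul1r metric_xi.
Qed.

Lemma eta_tilde_xi a : e (ξ a) = eps G p a.
Proof.
rewrite /eta_tilde (bigD1 a) //= eta_xi eqxx mulr1 big1 ?addr0 // => b ba.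
by rewrite eta_xi (negbTE ba) mulr0.
Qed.

Lemma eta_tilde_phi x : e (ph x) = 0.
Proof. by apply: big1 => a _; rewrite eta_phi mulr0. Qed.

Lemma eta_tilde_scalar : scalar e.
Proof.
move=> a u v; rewrite /eta_tilde mulr_sumr -big_split /=; apply: eq_bigr => b _.
by rewrite linearP /=; ring.
Qed.

Lemma metric_phi_scalar y : scalar (fun x => h x y).
Proof. by move=> a u v; rewrite linearP metric_scalarl. Qed.

Lemma scalar_phi_sqr (f : tangent p -> R) x :
  scalar f -> (forall a, f (ξ a) = 0) -> f x = - f (ph (ph x)).
Proof.
move=> f_scalar fxi; rewrite {1}(gff_decomp x) (scalarD f_scalar).
rewrite (scalarN f_scalar) (scalar_sum f_scalar) big1 ?addr0 // => a _.
by rewrite fxi mulr0.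
Qed.

(* The right-hand side of (b). *)
Definition model x y z w : R :=
  g (tensorS G x y z) w - g (tensorT G x y z) w.

(** With [∧] the Kulkarni-Nomizu product, the right-hand side is [h ∧ (e ⊗ e) - (1/2) h ∧ h]; its
    curvature symmetries follow from the symmetry of [h]. *)
Lemma modelE x y z w : model x y z w =
  h y z * h x w - h x z * h y w - h y z * e x * e w + h x z * e y * e w
  - e y * e z * h x w + e x * e z * h y w.
Proof.
rewrite /model /tensorS /tensorT.
rewrite !(scalarD (metric_scalarl _), scalarN (metric_scalarl _)).
rewrite !(scalarZ (metric_scalarl _)) !metric_phi_sqr metric_xi_tilde; ring.
Qed.

(** The range of [φ] is orthogonal to the timelike vector [ξ a]. *)
Lemma metric_phi_gt0 a x : eps G p a < 0 -> ph x != 0 -> 0 < g (ph x) (ph x).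
Proof.
move=> xi_lt0; apply: (lorentzian_form_pos (metric_lorentzian (gmet G) p)) xi_lt0 _.
by rewrite metric_xi eta_phi mulr0.
Qed.

Lemma metric_xi_add_phi a x y : g (ξ a + ph x) (ph y) = h x y.
Proof. by rewrite (scalarD (metric_scalarl _)) metric_xi eta_phi mulr0 add0r. Qed.

(** The first vector is null, as [-1 + 1 = 0], and orthogonal to [φ y], so the Gram determinant
    vanishes. Independence follows by applying [η a], which kills [φ x] and [φ y]. *)
Lemma degenerate_xi_add_phi a x y :
  eps G p a = -1 -> h x x = 1 -> h x y = 0 -> ph y != 0 ->
  degenerate_plane g (ξ a + ph x) (ph y).
Proof.
move=> epsE xx1 xy0 y_neq0; split=> [c|]; last first.
  rewrite metric_xi_add_phi xy0 (scalarD (metric_scalarr _)) metric_xi_add_phi xx1.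
  rewrite (scalarD (metric_scalarl (ξ a))) (metricC (ph x) (ξ a)) !metric_xi.
  by rewrite eta_phi eta_xi eqxx epsE /=; ring.
rewrite big_ord_recl big_ord1 !(tnth_nth 0) /= => c_eq0.
have c0 : c ord0 = 0.
  have := congr1 (η a) c_eq0.
  rewrite eta_scalar (scalarD (eta_scalar _)) (scalarZ (eta_scalar _)).
  by rewrite (scalar0 (eta_scalar _)) !eta_phi eta_xi eqxx /=; lra.
have : c (lift ord0 ord0) *: ph y = 0 by rewrite -[RHS]c_eq0 c0 scale0r add0r.
move/eqP; rewrite scaler_eq0 (negbTE y_neq0) orbF => /eqP c1 i.
by case: (unliftP ord0 i) => [j ->|-> //]; rewrite (ord1 j).
Qed.

(** * Comparison of [F] with the model *)

Section Curvature.
Context (F : tangent p -> tangent p -> tangent p -> tangent p -> R).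
Hypothesis F_curv : curvature_like F.

Let H x y z w := F x y z w - model x y z w.

Lemma curvature_like_sub_model : curvature_like H.
Proof.
have hC x y : h x y = h y x by rewrite metricC.
have [[F1 F2 F3 F4] FP FN FB] := F_curv.
have hl a u v y : h (a *: u + v) y = a * h u y + h v y by apply: metric_phi_scalar.
have hr a u v y : h y (a *: u + v) = a * h y u + h y v by rewrite !(hC y) hl.
split; [split| | |].
- by move=> y z w a u v; rewrite /H F1 !modelE !hl !eta_tilde_scalar; ring.
- by move=> x z w a u v; rewrite /H F2 !modelE !hl !eta_tilde_scalar; ring.
- by move=> x y w a u v; rewrite /H F3 !modelE !hr !eta_tilde_scalar; ring.
- by move=> x y z a u v; rewrite /H F4 !modelE !hr !eta_tilde_scalar; ring.
- move=> x y z w; rewrite /H FP !modelE.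
  by rewrite (hC w x) (hC z y) (hC w y) (hC z x); ring.
- move=> x y z w; rewrite /H !modelE; split; first by rewrite (FN x y _ _).1; ring.
  by rewrite (FN x y z w).2; ring.
- move=> x y z w; rewrite -[RHS](FB x y z w) /H !modelE.
  by rewrite (hC z x) (hC z y) (hC y x); ring.
Qed.

Hypothesis F_xi : forall x y a b, F x (ξ a) y (ξ b) = eps G p a * eps G p b * h x y.
Hypothesis F_phi : forall x y z a, F (ph x) (ph y) (ph z) (ξ a) = 0.

Lemma curvature_eq_model :
  (forall x y, F (ph x) (ph y) (ph x) (ph y) =
     h x y ^+ 2 - h x x * h y y) ->
  forall x y z w, F x y z w = model x y z w.
Proof.
move=> F_sec.
have [[H1 H2 H3 H4] HP HN HB] := curvature_like_sub_model.
have xil a y : h (ξ a) y = 0 by rewrite phi_xi (scalar0 (metric_scalarl _)).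
have xir a y : h y (ξ a) = 0 by rewrite metricC xil.
have Hxi24 x y a b : H x (ξ a) y (ξ b) = 0.
  by rewrite /H F_xi modelE !xil !xir !eta_tilde_xi; ring.
have Hxi14 x y a b : H (ξ a) x y (ξ b) = 0 by rewrite (HN _ _ _ _).1 Hxi24 oppr0.
(* The adjacent pair is not covered by [F_xi]; Bianchi reduces it to the two previous cases. *)
have Hxi34 x y a b : H x y (ξ a) (ξ b) = 0.
  by have := HB x y (ξ a) (ξ b); rewrite Hxi24 Hxi14 !addr0.
(* A second [ξ] in any other slot gives zero, so the other three arguments may be replaced by their
   [φ²], where [F_phi] applies. *)
have Hxi4 x y z a : H x y z (ξ a) = 0.
  rewrite (scalar_phi_sqr x (H1 _ _ _)) // (scalar_phi_sqr y (H2 _ _ _)) //.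
  rewrite (scalar_phi_sqr z (H3 _ _ _)) // /H F_phi modelE !xir.
  by rewrite !eta_tilde_phi; ring.
have Hxi3 x y w a : H x y (ξ a) w = 0 by rewrite (HN _ _ _ _).2 Hxi4 oppr0.
have Hxi2 x z w a : H x (ξ a) z w = 0 by rewrite HP Hxi4.
have Hxi1 y z w a : H (ξ a) y z w = 0 by rewrite HP Hxi3.
(* Precomposing with the linear map [φ] keeps [H] curvature-like, so vanishing on repeated pairs
   suffices. *)
have K0 x y z w : H (ph x) (ph y) (ph z) (ph w) = 0.
  apply: (@curvature_like_eq0 _ _ (fun x y z w => H (ph x) (ph y) (ph z) (ph w))).
    split; first split.
    - by move=> y' z' w' c u v /=; rewrite linearP H1.
    - by move=> x' z' w' c u v /=; rewrite linearP H2.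
    - by move=> x' y' w' c u v /=; rewrite linearP H3.
    - by move=> x' y' z' c u v /=; rewrite linearP H4.
    - by move=> *; apply: HP.
    - by move=> *; apply: HN.
    - by move=> *; apply: HB.
  move=> u v; rewrite /H F_sec modelE !metric_phi_phi !eta_tilde_phi.
  by rewrite (metricC (ph v)); ring.
move=> x y z w; apply/eqP; rewrite -subr_eq0; apply/eqP; rewrite -/(H x y z w).
rewrite (scalar_phi_sqr x (H1 _ _ _)) // (scalar_phi_sqr y (H2 _ _ _)) //.
rewrite (scalar_phi_sqr z (H3 _ _ _)) // (scalar_phi_sqr w (H4 _ _ _)) //.
by rewrite K0 !oppr0.
Qed.

(** * Sectional values on the range of [φ] from degenerate planes *)

Section NullSectional.
Variable o : 'I_s.
Hypothesis eps_o : eps G p o = -1.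
Hypothesis F_deg : forall u y, Nphi G (ξ o) u ->
  (orthogonal_to G u `&` range ph) y -> degenerate_plane g u y -> F u y u y = 0.

(* The hypothesis on the null vector [ξ o + k x], with [k x] a unit vector, reads
   [g(y, y) + k^2 F(x, y, x, y) = 0], the mixed terms vanishing by [F_phi]. *)
Lemma sectional_phi_orthogonal x y : h x y = 0 ->
  F (ph x) (ph y) (ph x) (ph y) = - (h x x * h y y).
Proof.
have [[F1 F2 F3 F4] FP FN _] := F_curv.
move=> xy0.
have [y0|y_neq0] := eqVneq (ph y) 0.
  by rewrite y0 (scalar0 (F2 _ _ _)) (scalar0 (metric_scalarl _)) mulr0 oppr0.
have [x0|x_neq0] := eqVneq (ph x) 0.
  by rewrite x0 (scalar0 (F1 _ _ _)) (scalar0 (metric_scalarl _)) mul0r oppr0.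
have xx_gt0 : 0 < h x x.
  by apply: (@metric_phi_gt0 o) x_neq0; rewrite eps_o ltrN10.
pose k := (Num.sqrt (g (ph x) (ph x)))^-1.
have kk : k ^+ 2 * g (ph x) (ph x) = 1.
  by rewrite exprVn sqr_sqrtr ?ltW // mulVf // gt_eqF.
have kx1 : g (ph (k *: x)) (ph (k *: x)) = 1.
  rewrite linearZ (scalarZ (metric_scalarl _)) (scalarZ (metric_scalarr _)).
  by rewrite mulrA -expr2.
have kxy0 : g (ph (k *: x)) (ph y) = 0.
  by rewrite linearZ (scalarZ (metric_scalarl _)) xy0 mulr0.
have : F (ξ o + ph (k *: x)) (ph y) (ξ o + ph (k *: x)) (ph y) = 0.
  apply: F_deg; last exact: degenerate_xi_add_phi.
    by exists (ph (k *: x)) => //; split=> //; exists (k *: x).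
  split; last by exists y.
  by rewrite /orthogonal_to /= metric_xi_add_phi.
have F_xixi : F (ξ o) (ph y) (ξ o) (ph y) = g (ph y) (ph y).
  rewrite (FN _ _ _ _).1 (FN _ _ _ _).2 opprK F_xi metric_phi_phi eps_o.
  by rewrite mulrNN !mul1r.
have F_xi3 : F (ph x) (ph y) (ξ o) (ph y) = 0.
  by rewrite (FN _ _ _ _).2 F_phi oppr0.
have F_xi1 : F (ξ o) (ph y) (ph x) (ph y) = 0 by rewrite FP.
rewrite linearZ (scalarD (F1 _ _ _)) (scalarZ (F1 _ _ _)).
rewrite !(scalarD (F3 _ _ _)) !(scalarZ (F3 _ _ _)).
rewrite F_xixi F_xi3 F_xi1 => Fk; apply/eqP; rewrite -subr_eq0 opprK; apply/eqP.
(* The factor [h x x] cancels the normalization, since [k ^+ 2 * h x x = 1]. *)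
transitivity (h x x * (k ^+ 2 * F (ph x) (ph y) (ph x) (ph y) + h y y)).
  by rewrite mulrDr mulrA [_ * k ^+ 2]mulrC kk mul1r.
by apply/eqP; rewrite mulf_eq0 gt_eqF //=; apply/eqP; rewrite -[RHS]Fk; ring.
Qed.

(** Gram-Schmidt: subtracting from [φ y] its projection on [φ x] reaches the orthogonal case, and
    leaves [F (φ x) (φ y) (φ x) (φ y)] unchanged because [F] is alternating in each pair. *)
Lemma sectional_phi x y :
  F (ph x) (ph y) (ph x) (ph y) = h x y ^+ 2 - h x x * h y y.
Proof.
have [[F1 F2 F3 F4] FP FN _] := F_curv.
have [x0|x_neq0] := eqVneq (ph x) 0.
  rewrite x0 (scalar0 (F1 _ _ _)) !(scalar0 (metric_scalarl _)).
  by rewrite expr0n mul0r subrr.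
have xx_gt0 : 0 < h x x.
  by apply: (@metric_phi_gt0 o) x_neq0; rewrite eps_o ltrN10.
pose c := g (ph x) (ph y) / g (ph x) (ph x).
have cE : c * g (ph x) (ph x) = g (ph x) (ph y) by rewrite divfK // gt_eqF.
have phyE : ph (y - c *: x) = ph y - c *: ph x by rewrite linearB linearZ.
have F0 a b d : F a a b d = 0 /\ F b d a a = 0.
  by have := (FN a a b d).1; rewrite (FP b d); lra.
have := @sectional_phi_orthogonal x (y - c *: x); rewrite phyE.
rewrite !(scalarBZ (metric_scalarr _)) !(scalarBZ (metric_scalarl _)).
rewrite (scalarBZ (F2 _ _ _)) !(scalarBZ (F4 _ _ _)).
rewrite !(F0 _ _ _).1 !(F0 _ _ _).2 !(mulr0, subr0) (metricC (ph y)) -cE.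
by rewrite subrr => /(_ erefl) ->; ring.
Qed.

End NullSectional.

End Curvature.

End LorentzianGff.

Theorem lemma4p2 (R : realType) (n s : nat) (s_ge1 : (1 <= s)%N)
    (M : smooth_manifold R (2 * n + s)) (G : lorentzian_gff M)
    (xi1_timelike : forall q : M, eps G q (Ordinal s_ge1) < 0)
    (p : M) (F : tangent p -> tangent p -> tangent p -> tangent p -> R)
    (F_curv : curvature_like F)
    (F_xi : forall (x y : tangent p) (a b : 'I_s),
       F x (xi G a p) y (xi G b p) =
       eps G p a * eps G p b * gmet G p (phi G p x) (phi G p y))
    (F_phi : forall (x y z : tangent p) (a : 'I_s),
       F (phi G p x) (phi G p y) (phi G p z) (xi G a p) = 0) :
  (forall u y : tangent p,
     Nphi G (xi G (Ordinal s_ge1) p) u ->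
     (orthogonal_to G u `&` range (phi G p)) y ->
     degenerate_plane (gmet G p) u y ->
     F u y u y = 0)
  <->
  (forall x y z w : tangent p,
     F x y z w = gmet G p (tensorS G x y z) w - gmet G p (tensorT G x y z) w).
Proof.
set o := Ordinal s_ge1.
have eps_o : eps G p o = -1.
  by have [|//] := xi_unit G p o; have := xi1_timelike p; rewrite /eps -/o; lra.
(* For (b) implies (a), the model at [u = ξ o + φ x], [v = φ y] reduces to [- h y y + h y y]: the
   first term comes from [S] with [h x x = 1], the second from [T] with [e u = -1]. *)
split=> [F_deg|FE u v [_ [[x _ <-] xx1] <-] [+ [y _ yv]] _]; last first.
  rewrite -{v}yv /orthogonal_to /= metric_xi_add_phi => xy0.
  rewrite FE -/(model _ _ _ _ _) modelE linearD phi_xi add0r !metric_phi_phi.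
  rewrite (scalarD (eta_tilde_scalar G (p:=p))) !eta_tilde_phi eta_tilde_xi eps_o.
  by rewrite xx1 xy0; ring.
move=> x y z w; rewrite -/(model _ _ _ _ _).
exact/curvature_eq_model/(sectional_phi F_curv F_xi F_phi eps_o F_deg).
Qed.
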